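(* Let $p_1,p_2,p_3,p_4>0$ with $\sum_{l=1}^4p_l=1$ and $|p_1-p_3|+|p_2-p_4|\neq0$, let $q=(p_1-p_3,\,p_2-p_4)'$, let $\alpha\in(0,\infty)$, and let $e\in\mathbb{R}^2$ be a fixed source site belonging to $h_0\mathbb{Z}^2$ for some $h_0>0$. For $h>0$ with $e\in h\mathbb{Z}^2$, let $\mu^h=(\mu^h_t)_{t\ge0}\in D([0,\infty):\mathbb{M})$ be the measure-valued path of expected particle numbers defined in the context, and let $\mu=(\mu_t)_{t\ge 0}$ with $\mu_t(dx)=\mu(t,dx)=\alpha\int_0^t\delta_{e+qs}(dx)\,ds$. Then, as $h\to0$ (through values with $e\in h\mathbb{Z}^2$), $\mu^h\to\mu$ in $D([0,\infty):\mathbb{M})$.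
   Context: $\mathbb{M}$ is the space of finite (nonnegative) Borel measures on $\mathbb{R}^2$ with the topology of weak convergence (Polish under a suitable metric). $D([0,\infty):\mathbb{M})$ is the space of functions from $[0,\infty)$ to $\mathbb{M}$ that are right continuous with left limits, with the usual Skorohod topology. $\delta_y(dx)$ is the Dirac measure at $y\in\mathbb{R}^2$. Let $e_1=(1,0)'$, $e_2=(0,1)'$, $e_3=-e_1$, $e_4=-e_2$ (the unsubscripted $e$ is the source site). For $h>0$ with $e\in h\mathbb{Z}^2$, let $(X_n)_{n\ge0}$ be, under $\mathbb{P}_e=\mathbb{P}_e^h$, the Markov chain on $h\mathbb{Z}^2$ with $X_0=e$ a.s. and transition probabilities $\mathbb{P}_e[X_n=x+he_l\mid X_{n-1}=x]=p_l$, $l=1,\dots,4$. Consider the particle system in which at each time $nh$, $n\ge0$, a random number $\alpha_n$ of particles is injected at $e$, where $(\alpha_n)_{n\ge0}$ are i.i.d. with values in the nonnegative integers and $\mathbb{E}\alpha_n=\alpha h$, and each particle, after entering, moves independently of everything else according to this Markov chain, one step per time increment $h$. Let $N_n(w)$ be the number of particles at $w\in h\mathbb{Z}^2$ at time $nh$ and $$\mu_n(w)=\mathbb{E}N_n(w)=\alpha h\sum_{k=0}^n\mathbb{P}_e(X_k=w),\qquad n\ge 0.$$ Define $\tilde\mu^h(t,x)=\mu_{\lfloor t/h\rfloor}(h\lfloor x/h\rfloor)$ for $(t,x)\in[0,\infty)\times\mathbb{R}^2$ (with $\lfloor\cdot\rfloor$ taken componentwise on vectors), and for $t\ge0$ and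 Borel $A\subseteq\mathbb{R}^2$, $$\mu^h_t(A)=\sum_{x\in A\cap h\mathbb{Z}^2}\tilde\mu^h(t,x).$$ The parameters $p_1,\dots,p_4$, $\alpha$ and $e$ do not depend on $h$. *)

(* Defs.v *)
From HB Require Import structures.
From mathcomp Require Import all_boot all_order all_algebra.
From mathcomp Require Import all_classical all_reals all_analysis.
From mathcomp Require Import measurable_realfun.
Import Order.TTheory GRing.Theory Num.Theory.
Import numFieldNormedType.Exports.

Set Implicit Arguments.
Unset Strict Implicit.
Unset Printing Implicit Defensive.

Local Open Scope classical_set_scope.
Local Open Scope ring_scope.

(* A [measure] of the library is a function on all sets, constrained only on
   measurable ones: two elements of this type denote the same Borel measure as
   soon as they agree on measurable sets. *)
Definition finmeas (R : realType) : Type :=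
  {finite_measure set (R * R)%type -> \bar R}.

Definition bounded_continuous (R : realType) : Type :=
  {f : R * R -> R | continuous f /\ exists K : R, forall x, `|f x| <= K}.

Definition test_integrals (R : realType) (m : finmeas R) :
    {ptws bounded_continuous R -> R} :=
  fun f => \int[m]_x (sval f x).

HB.instance Definition _ (R : realType) := gen_eqMixin (finmeas R).
HB.instance Definition _ (R : realType) := gen_choiceMixin (finmeas R).
(* weak convergence: the coarsest topology making all [m |-> \int f dm],
   [f] bounded continuous, continuous *)
HB.instance Definition _ (R : realType) :=
  Topological.copy (finmeas R) (initial_topology (@test_integrals R)).

(* [r] is a metric inducing the topology of weak convergence; separation is
   stated up to equality on measurable sets, see [finmeas]. *)
Definition metrizes_weak (R : realType) (r : finmeas R -> finmeas R -> R) :=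
  [/\ forall m1 m2, 0 <= r m1 m2,
      forall m1 m2, r m1 m2 = 0 <->
        (forall A : set (R * R), measurable A -> m1 A = m2 A),
      forall m1 m2, r m1 m2 = r m2 m1,
      forall m1 m2 m3, r m1 m3 <= r m1 m2 + r m2 m3 &
      forall U : set (finmeas R), open U <->
        (forall m, U m -> exists2 eps : R, 0 < eps &
           forall m', r m m' < eps -> U m')].

(* Paths are indexed by [R]; only their values on [0, +oo) are ever used. *)
Definition cadlag (R : realType) (x : R -> finmeas R) :=
  (forall t, 0 <= t -> x @ t^'+ --> x t) /\
  (forall t, 0 < t -> exists l : finmeas R, x @ t^'- --> l).

Definition time_change (R : realType) (lam : R -> R) :=
  (forall s t, 0 <= s -> s < t -> lam s < lam t) /\
  lam @` [set t | 0 <= t] = [set t | 0 <= t].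

Definition log_slope (R : realType) (lam : R -> R) : \bar R :=
  ereal_sup [set (`|ln ((lam s.1 - lam s.2) / (s.1 - s.2))|)%:E |
             s in [set s : R * R | 0 <= s.2 < s.1]].

Definition stopped_dist (R : realType) (r : finmeas R -> finmeas R -> R)
    (x y : R -> finmeas R) (lam : R -> R) (u : R) : \bar R :=
  ereal_sup [set (Num.min (r (x (Num.min t u)) (y (Num.min (lam t) u))) 1)%:E |
             t in [set t | 0 <= t]].

(* The Skorohod metric on [D([0, +oo) : E)], [E] metrized by [r]
   (Ethier and Kurtz, Markov Processes, Section 3.5). *)
Definition skorohod_dist (R : realType) (r : finmeas R -> finmeas R -> R)
    (x y : R -> finmeas R) : \bar R :=
  ereal_inf [set maxe (log_slope lam)
      (\int[lebesgue_measure]_(u in `[0%R, +oo[)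
         ((expR (- u))%:E * stopped_dist r x y lam u))%E |
    lam in [set lam | time_change lam /\ (log_slope lam < +oo)%E]].

Definition lattice (R : realType) (h : R) : set (R * R) :=
  [set x | exists a b : int, x = (h * a%:~R, h * b%:~R)].

Definition admissible (R : realType) (e : R * R) (h : R) :=
  0 < h /\ lattice h e.

(* [unit_step l] is e_(l+1): indices run over {0, 1, 2, 3}. *)
Definition unit_step (R : realType) (l : 'I_4) : R * R :=
  nth 0 [:: (1, 0); (0, 1); (- 1, 0); (0, - 1)] l.

Definition hop (R : realType) (h : R) (l : 'I_4) : R * R :=
  (h * (unit_step R l).1, h * (unit_step R l).2).

Definition drift (R : realType) (p : 'I_4 -> R) : R * R :=
  (p 0 - p 2, p 1 - p 3).

Section probability.
Context d (T : measurableType d) (R : realType) (P : probability T R).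

(* The Markov property, with the conditioning on the whole past cleared of its
   denominator. *)
Definition markov_walk (p : 'I_4 -> R) (e : R * R) (h : R)
    (X : nat -> T -> R * R) :=
  [/\ forall k w, lattice h (X k w),
      forall k, measurable_fun setT (X k),
      P [set w | X 0%N w = e] = 1%E &
      forall n (x : nat -> R * R) (l : 'I_4),
        P [set w | (forall k, (k <= n)%N -> X k w = x k) /\
                   X n.+1 w = x n + hop h l] =
        ((p l)%:E * P [set w | forall k, (k <= n)%N -> X k w = x k])%E].

Definition independent (I : eqType) (G : I -> set (set T)) :=
  forall (s : seq I) (E : I -> set T), uniq s ->
    (forall i, i \in s -> G i (E i)) ->
    P (\bigcap_(i in [set` s]) E i) = (\prod_(i <- s) P (E i))%E.

Definition sigma_nat (X : T -> nat) : set (set T) :=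
  [set X @^-1` B | B in [set: set nat]].

Definition sigma_path (X : nat -> T -> R * R) : set (set T) :=
  <<s [set E | exists k (B : set (R * R)),
                 measurable B /\ E = X k @^-1` B] >>.

End probability.

(* [injected m] is the number of particles entering at time [m * h], and
   [walk m j k] the position, [k] steps after its injection, of the [j]-th of
   the particles entering at time [m * h]. Walks are given for all [j], but
   only those with [j < injected m w] correspond to actual particles. *)
Record particle_system (R : realType) (p : 'I_4 -> R) (alpha : R)
    (e : R * R) (h : R) := ParticleSystem {
  ps_display : measure_display;
  ps_space : measurableType ps_display;
  ps_prob : probability ps_space R;
  injected : nat -> ps_space -> nat;
  walk : nat -> nat -> nat -> ps_space -> R * R;
  injected_measurable : forall m, measurable_fun setT (injected m);
  injected_ident : forall m (B : set nat),
    ps_prob (injected m @^-1` B) = ps_prob (injected 0 @^-1` B);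
  injected_mean : forall m,
    ('E_ps_prob[(fun w => (injected m w)%:R : R)] = (alpha * h)%:E)%E;
  walk_markov : forall m j, markov_walk ps_prob p e h (walk m j);
  ps_independent : independent ps_prob (fun i : nat + nat * nat =>
    match i with
    | inl m => sigma_nat (injected m)
    | inr mj => sigma_path (walk mj.1 mj.2)
    end)
}.

Section expected_numbers.
Context (R : realType) (p : 'I_4 -> R) (alpha : R) (e : R * R) (h : R).
Variable S : particle_system p alpha e h.
Local Notation T := (ps_space S).
Local Notation P := (ps_prob S).

Definition particles_at (n : nat) (x : R * R) (w : T) : nat :=
  \sum_(m < n.+1) \sum_(j < injected m w) (walk m j (n - m) w == x).

Definition mean_at (n : nat) (x : R * R) : \bar R :=
  'E_P[(fun w => (particles_at n x w)%:R : R)].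

Definition round_down (x : R * R) : R * R :=
  (h * (Num.floor (x.1 / h))%:~R, h * (Num.floor (x.2 / h))%:~R).

Definition scaled_mean (t : R) (x : R * R) : \bar R :=
  mean_at (Num.truncn (t / h)) (round_down x).

Definition path_measure (t : R) (A : set (R * R)) : \bar R :=
  \esum_(x in A `&` lattice h) scaled_mean t x.

Let path_measure0 t : path_measure t set0 = 0%E.
Proof. by rewrite /path_measure set0I esum_set0. Qed.

Let mean_at_ge0 n x : (0 <= mean_at n x)%E.
Proof. by rewrite /mean_at; apply: expectation_ge0 => w. Qed.

Let path_measure_ge0 t A : (0 <= path_measure t A)%E.
Proof. by apply: esum_ge0 => x _; exact: mean_at_ge0. Qed.

Let path_measure_sigma_additive t : semi_sigma_additive (path_measure t).
Proof.
move=> F mF tF mUF.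
rewrite [X in _ --> X](_ : _ = \sum_(0 <= i <oo) path_measure t (F i))%E.
  by apply: is_cvg_nneseries => n _ _; exact: path_measure_ge0.
rewrite nneseries_esumT; last by move=> n; exact: path_measure_ge0.
rewrite /path_measure setI_bigcupl esum_bigcupT//.
- exact: trivIset_setIr.
- by move=> x; exact: mean_at_ge0.
Qed.

HB.instance Definition _ t := isMeasure.Build _ _ R (path_measure t)
  (path_measure0 t) (path_measure_ge0 t) (@path_measure_sigma_additive t).

Let round_down_lattice x : lattice h x -> round_down x = x.
Proof.
move=> [a [b ->]]; rewrite /round_down /=.
have E (c : int) : h * (Num.floor (h * c%:~R / h))%:~R = h * c%:~R.
  have [->|h0] := eqVneq h 0; first by rewrite !mul0r.
  by rewrite [h * _ / h]mulrAC divff// mul1r (floor_def (m := c))// lexx ltr_int ltzD1 lexx.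
by rewrite !E.
Qed.

Let measurable_walk_at m j k x :
  measurable_fun setT (fun w : T => walk m j k w == x : nat).
Proof.
apply: measurable_fun_ifT => //.
apply: (@measurable_fun_bool _ _ _ _ true).
rewrite (_ : _ @^-1` _ = walk m j k @^-1` ([set x.1] `*` [set x.2])).
  have [_ + _ _] := walk_markov S m j; apply => //.
  by apply: measurableX; exact: measurable_set1.
by apply/seteqP; split => w /=; case: (walk m j k w) x => a b [c d] /=;
  [move/eqP => [-> ->]|case=> -> ->; rewrite eqxx].
Qed.

Let measurable_sum_nat d (U : measurableType d) n (f : nat -> U -> nat) :
  (forall i, measurable_fun setT (f i)) ->
  measurable_fun setT (fun w => \sum_(i < n) f i w)%N.
Proof.
move=> mf; elim: n => [|n IHn].
  by under eq_fun do rewrite big_ord0; exact: measurable_cst.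
under eq_fun do rewrite big_ord_recr.
exact: measurable_realfun.measurable_fun_addn.
Qed.

Let particles_at_measurable n x : measurable_fun setT (particles_at n x).
Proof.
apply: (@measurable_sum_nat _ _ _ (fun m w =>
  \sum_(j < injected m w) (walk m j (n - m) w == x))%N) => m.
move=> _ B _; rewrite setTI.
rewrite [X in measurable X](_ : _ = \bigcup_a (injected m @^-1` [set a] `&`
  (fun w : T => \sum_(j < a) (walk m j (n - m) w == x))%N @^-1` B)); last first.
  apply/seteqP; split => [w Bw|w [a _ [<-]]//].
  by exists (injected m w).
apply: bigcup_measurable => a _; apply: measurableI.
  by rewrite -[X in measurable X]setTI; exact: injected_measurable.
rewrite -[X in measurable X]setTI.
apply: (@measurable_sum_nat _ _ _ (fun j w => walk m j (n - m) w == x : nat)) => //.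
Qed.

Let particles_sum_le n (s : seq (R * R)) (w : T) : uniq s ->
  (\sum_(x <- s) particles_at n x w <= \sum_(m < n.+1) injected m w)%N.
Proof.
move=> us; rewrite exchange_big leq_sum// => m _.
rewrite exchange_big /=.
rewrite -[leqRHS]card_ord -sum1_card leq_sum// => j _.
under eq_bigr do rewrite eq_sym.
have -> : (\sum_(i <- s) (i == walk m j (n - m) w) = (walk m j (n - m) w \in s) :> nat)%N.
  by rewrite -count_uniq_mem// -sum1_count [RHS]big_mkcond.
exact: leq_b1.
Qed.

Let path_measure_fin t : fin_num_fun (path_measure t).
Proof.
move=> A mA; set n := Num.truncn (t / h).
have mnat (f : T -> nat) : measurable_fun setT f ->
    measurable_fun setT (EFin \o (fun w => (f w)%:R : R)).
  move=> mf; apply/measurable_EFinP.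
  exact: measurableT_comp.
rewrite ge0_fin_numE; last exact: path_measure_ge0.
apply: (@le_lt_trans _ _ (\sum_(m < n.+1) (alpha * h)%:E)%E); last first.
  by rewrite sumEFin ltry.
apply: ge_ereal_sup => _ [X [finX XA] <-].
rewrite fsbig_finite//=.
have -> : (\sum_(x <- finmap.enum_fset (fset_set X)) scaled_mean t x =
    \sum_(x <- finmap.enum_fset (fset_set X))
       \int[P]_w ((particles_at n x w)%:R)%:E)%E.
  apply: eq_big_seq => x; rewrite in_fset_set// inE => /XA[_ Lx].
  by rewrite /scaled_mean round_down_lattice// /mean_at unlock.
rewrite -ge0_integral_sum//; last by move=> x; exact: mnat.
have -> : (\sum_(m < n.+1) (alpha * h)%:E =
    \int[P]_w (\sum_(m < n.+1) ((injected m w)%:R)%:E))%E.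
  rewrite ge0_integral_sum//; last first.
    by move=> m; apply: mnat; exact: injected_measurable.
  by apply: eq_bigr => m _; rewrite -(injected_mean S m) unlock.
apply: ge0_le_integral => //.
- by move=> w _; apply: sume_ge0.
- by apply: emeasurable_sum => x; exact: mnat.
- by apply: emeasurable_sum => m; apply: mnat; exact: injected_measurable.
move=> w _; rewrite !sumEFin lee_fin -!natr_sum ler_nat.
by apply: particles_sum_le; exact: finmap.fset_uniq.
Qed.

HB.instance Definition _ t := Measure_isFinite.Build _ _ R (path_measure t)
  (@path_measure_fin t).

Definition measure_path (t : R) : finmeas R :=
  (path_measure t : {finite_measure set (R * R)%type -> \bar R}).

End expected_numbers.

Section limit.
Context (R : realType) (alpha : {posnum R}) (e q : R * R).

Definition limit_measure (t : R) (A : set (R * R)) : \bar R :=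
  (alpha%:num%:E *
   \int[lebesgue_measure]_(s in `[0%R, t]) \d_(e.1 + q.1 * s, e.2 + q.2 * s)%R A)%E.

Let limit0 t : limit_measure t set0 = 0%E.
Proof.
by rewrite /limit_measure; under eq_integral do rewrite measure0;
  rewrite integral0 mule0.
Qed.

Let limit_ge0 t A : (0 <= limit_measure t A)%E.
Proof. by apply: mule_ge0 => //; apply: integral_ge0. Qed.

Let limit_meas A : measurable A -> measurable_fun setT
  (fun s : R => \d_(e.1 + q.1 * s, e.2 + q.2 * s) A : \bar R).
Proof.
move=> mA.
pose g (s : R) := (e.1 + q.1 * s, e.2 + q.2 * s).
rewrite (_ : (fun s => _) = EFin \o (\1_A \o g)) //.
apply/measurable_EFinP/measurableT_comp; first exact: measurable_indic.
apply: measurable_fun_pair; apply: measurable_funD => //;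
  exact: measurable_funM.
Qed.

Let limit_sigma_additive t : semi_sigma_additive (limit_measure t).
Proof.
move=> F mF tF mUF.
rewrite [X in _ --> X](_ : _ = \sum_(0 <= i <oo) limit_measure t (F i))%E.
  by apply: is_cvg_nneseries => n _ _; exact: limit_ge0.
rewrite nneseriesZl//; last by move=> n _; exact: integral_ge0.
rewrite -integral_nneseries//.
- by congr (_ * _)%E; apply: eq_integral => s _; rewrite measure_semi_bigcup.
- by move=> n; apply: measurable_funTS; exact: limit_meas.
Qed.

HB.instance Definition _ t := isMeasure.Build _ _ R (limit_measure t)
  (limit0 t) (limit_ge0 t) (@limit_sigma_additive t).

Let limit_fin t : fin_num_fun (limit_measure t).
Proof.
move=> A mA; rewrite ge0_fin_numE; last exact: limit_ge0.
rewrite /limit_measure lte_mul_pinfty//.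
apply: (@le_lt_trans _ _ (\int[lebesgue_measure]_(s in `[0%R, t]) cst 1 s)%E).
  apply: ge0_le_integral => //.
  - by apply: measurable_funTS; exact: limit_meas.
  - by move=> s _; rewrite diracE; case: (_ \in _); rewrite ?lee_fin ?ler01.
rewrite integral_cst//= mul1e lebesgue_measure_itv/=.
by case: ifP => _; rewrite ?ltry// -EFinD ltry.
Qed.

HB.instance Definition _ t := Measure_isFinite.Build _ _ R (limit_measure t)
  (@limit_fin t).

Definition limit_path (t : R) : finmeas R :=
  (limit_measure t : {finite_measure set (R * R)%type -> \bar R}).

End limit.

(* Main.v *)
Require Import Defs.
From mathcomp Require Import all_boot all_order all_algebra.
From mathcomp Require Import all_classical all_reals all_analysis.
From mathcomp Require Import measurable_realfun ring lra.
Import Order.TTheory GRing.Theory Num.Theory.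
Import numFieldNormedType.Exports.
Local Open Scope classical_set_scope.
Local Open Scope ring_scope.
Set Implicit Arguments.
Unset Strict Implicit.
Unset Printing Implicit Defensive.

(** The mean number of particles at a point is computed exactly, and the limit is
    a law of large numbers for one walk followed by a Riemann sum.

    Particles enter at a mean rate [alpha * h] per time step, independently of
    their walks, so that at time [t], with [n] the integer part of [t / h],
    the measure [path_measure t] is [\sum_(m <= n) alpha * h * law(X_m)]
    ([path_measureE]). The law of [X_m] is a finite combination of Dirac masses
    indexed by the words of [m] steps ([markov_walk_law]), and integrating against
    it is a finite sum, [walk_mean]. The distance between [X_m] and the point
    [e + q m h] has second moment at most [m * h ^+ 2] ([walk_mean_sqdist]), which
    is of order [h] when [m * h] stays bounded. For a bounded continuous [f],
    the expectation of [f X_m] is therefore close to [f (e + q m h)], and the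
    integral of [f] against [path_measure t] to a Riemann sum of
    [alpha * \int_0^t f (e + q s) ds], uniformly for [t] in a compact interval
    ([uniform_test_convergence]).

    The limit path is weakly continuous, so that this implies joint weak
    convergence as the mesh tends to 0 and the time to [t]; by compactness of
    [[0, T]], any metric of the weak topology then converges uniformly on
    [[0, T]] ([uniform_weak_convergence]). Uniform convergence on compact time
    intervals bounds the Skorohod distance through the identity time change, since
    large stopping times are exponentially discounted ([skorohod_dist_uniform]). *)

(** * Walks as words of steps *)

Section words.
Context (R : realType) (p : 'I_4 -> R) (e : R * R) (h : R).

(** A word lists the steps of a walk from the last one to the first: one more
    step is one more letter at the head. *)
Fixpoint words (n : nat) : seq (seq 'I_4) :=
  if n is n'.+1 then [seq l :: s | l <- index_enum 'I_4, s <- words n']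
  else [:: [::]].

Definition weight (s : seq 'I_4) : R := \prod_(l <- s) p l.

Definition endpoint (s : seq 'I_4) : R * R :=
  foldr (fun l x => x + hop h l) e s.

Definition walk_mean (n : nat) (f : R * R -> R) : R :=
  \sum_(s <- words n) weight s * f (endpoint s).

Lemma words_uniq n : uniq (words n).
Proof.
elim: n => //= n IHn; apply: allpairs_uniq => //; first exact: index_enum_uniq.
by move=> [l s] [l' s'] _ _ /= [-> ->].
Qed.

Lemma size_words n s : s \in words n -> size s = n.
Proof.
elim: n s => [|n IHn] s /=; first by rewrite inE => /eqP ->.
by case/allpairsP => -[l s'] /= [_ /IHn <- ->].
Qed.

Lemma weight_cons l s : weight (l :: s) = p l * weight s.
Proof. by rewrite /weight big_cons. Qed.

Lemma walk_mean0 f : walk_mean 0 f = f e.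
Proof. by rewrite /walk_mean big_seq1 /weight big_nil mul1r. Qed.

(** Averaging over the last step first makes the mass and the second moment of
    the law accessible to induction on the number of steps. *)
Lemma walk_meanS n f :
  walk_mean n.+1 f = walk_mean n (fun x => \sum_l p l * f (x + hop h l)).
Proof.
rewrite /walk_mean big_allpairs_dep exchange_big; apply: eq_bigr => s _.
rewrite mulr_sumr; apply: eq_bigr => l _.
by rewrite weight_cons /= mulrCA mulrA.
Qed.

Hypothesis p_ge0 : forall l, 0 <= p l.
Hypothesis p_sum1 : \sum_l p l = 1.

Lemma weight_ge0 s : 0 <= weight s.
Proof. exact: prodr_ge0. Qed.

Lemma le_walk_mean n f g : (forall x, f x <= g x) ->
  walk_mean n f <= walk_mean n g.
Proof. by move=> fg; apply: ler_sum => s _; rewrite ler_wpM2l// weight_ge0. Qed.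

Lemma walk_mean_cst n c : walk_mean n (fun=> c) = c.
Proof.
elim: n => [|n IHn]; first by rewrite walk_mean0.
by rewrite walk_meanS -[RHS]IHn; under [fun=> _]eq_fun do rewrite -mulr_suml p_sum1 mul1r.
Qed.

Lemma walk_meanD n f g :
  walk_mean n (fun x => f x + g x) = walk_mean n f + walk_mean n g.
Proof. by rewrite -big_split; apply: eq_bigr => s _; rewrite mulrDr. Qed.

Lemma walk_meanZ n c f : walk_mean n (fun x => c * f x) = c * walk_mean n f.
Proof. by rewrite mulr_sumr; apply: eq_bigr => s _; rewrite mulrCA. Qed.

Definition sqdist (x y : R * R) : R := (x.1 - y.1) ^+ 2 + (x.2 - y.2) ^+ 2.

Definition ray (q : R * R) (s : R) : R * R := (e.1 + q.1 * s, e.2 + q.2 * s).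

Lemma sum_ord4 (F : 'I_4 -> R) : \sum_l F l = F 0 + F 1 + F 2 + F 3.
Proof.
rewrite !big_ord_recl big_ord0 addr0 !addrA.
by congr (F _ + F _ + F _ + F _); apply: val_inj.
Qed.

(** The mean step is [h] times the drift, so moving the reference point with the
    drift cancels the cross term of the expanded square; what remains is the
    variance of one step, [h ^+ 2 * (1 - |q|^2)]. *)
Lemma sqdist_step x y :
  \sum_l p l * sqdist (x + hop h l) (y + (h * (drift p).1, h * (drift p).2)) <=
  sqdist x y + h ^+ 2.
Proof.
move: p_sum1; rewrite !sum_ord4 /sqdist /hop /unit_step /drift/=.
move: (p 0) (p 1) (p 2) (p 3) x y => a b c d [x1 x2] [y1 y2] /= s1.
have {s1} -> : a = 1 - b - c - d by lra.
rewrite -subr_ge0.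
set E := (X in 0 <= X).
have -> : E = h ^+ 2 * ((1 - b - c - d - c) ^+ 2 + (b - d) ^+ 2).
  by rewrite /E; ring.
by rewrite mulr_ge0 ?addr_ge0 ?sqr_ge0.
Qed.

(** The variances of the steps add up. With [n] of order [1 / h] this is of
    order [h]: the law of large numbers for the rescaled walk. *)
Lemma walk_mean_sqdist n :
  walk_mean n (sqdist^~ (ray (drift p) (n%:R * h))) <= n%:R * h ^+ 2.
Proof.
elim: n => [|n IHn].
  by rewrite walk_mean0 /sqdist /ray/= !mul0r !mulr0 !addr0 !subrr expr0n/= addr0.
rewrite walk_meanS.
have -> : ray (drift p) (n.+1%:R * h) =
    ray (drift p) (n%:R * h) + (h * (drift p).1, h * (drift p).2).
  by rewrite /ray/=; congr pair => /=; rewrite -natr1; ring.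
apply: le_trans (le_walk_mean _ (fun x => sqdist_step x _)) _.
by rewrite walk_meanD walk_mean_cst -natr1 mulrDl mul1r lerD2r.
Qed.

(** Chebyshev's inequality in integrated form: the two cases, near and far from
    the centre, merge into the bound
    [`|f y - f c| <= eps + 2 * K / delta * sqdist y c], valid for all [y]. *)
Lemma walk_mean_concentration n f (K eps delta : R) : 0 < delta ->
  (forall x, `|f x| <= K) ->
  (forall y, sqdist y (ray (drift p) (n%:R * h)) < delta ->
     `|f y - f (ray (drift p) (n%:R * h))| <= eps) ->
  `|walk_mean n f - f (ray (drift p) (n%:R * h))| <=
    eps + 2 * K / delta * (n%:R * h ^+ 2).
Proof.
set c := ray _ _ => d0 fK fe.
have K0 : 0 <= K by apply: le_trans (fK c).
have eps0 : 0 <= eps.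
  by apply: le_trans (fe c _) => //; rewrite /sqdist !subrr expr0n/= addr0.
have sq0 y : 0 <= sqdist y c by rewrite addr_ge0// sqr_ge0.
have bnd y : `|f y - f c| <= eps + 2 * K / delta * sqdist y c.
  have [yd|dy] := ltP (sqdist y c) delta.
    by apply: le_trans (fe _ yd) _; rewrite lerDl mulr_ge0// divr_ge0 ?mulr_ge0// ltW.
  apply: (@le_trans _ _ (2 * K)).
    rewrite (le_trans (ler_normB _ _))// mulrDl mul1r lerD//.
  rewrite -[leLHS]add0r lerD// -mulrA ler_peMr ?mulr_ge0//.
  by rewrite mulrC ler_pdivlMr// mul1r.
have meanle : walk_mean n (fun y => eps + 2 * K / delta * sqdist y c) <=
    eps + 2 * K / delta * (n%:R * h ^+ 2).
  rewrite walk_meanD walk_mean_cst walk_meanZ lerD2l ler_wpM2l//.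
    by rewrite divr_ge0 ?mulr_ge0// ltW.
  exact: walk_mean_sqdist.
apply: le_trans meanle.
have -> : walk_mean n f - f c = walk_mean n (fun y => f y - f c).
  by rewrite walk_meanD walk_mean_cst.
rewrite ler_norml -[X in X <= _]mulN1r -walk_meanZ !le_walk_mean// => y;
  by have := bnd y; rewrite ler_norml => /andP[]; lra.
Qed.

End words.

(** * The law of the walk *)

Lemma measurable_point (R : realType) (x : R * R) : measurable [set x].
Proof.
rewrite (_ : [set x] = [set x.1] `*` [set x.2]).
  by apply: measurableX; exact: measurable_set1.
apply/seteqP; split => [_ ->//|[a b] /= [-> ->]]; exact/esym/surjective_pairing.
Qed.

Section walk_law.
Context d (T : measurableType d) (R : realType) (P : probability T R).
Context (p : 'I_4 -> R) (e : R * R) (h : R) (X : nat -> T -> R * R).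
Hypothesis p_sum1 : \sum_l p l = 1.
Hypotheses (h_neq0 : h != 0) (XM : markov_walk P p e h X).

(** The trajectory is prescribed at all times, as the Markov property conditions
    on the whole past. *)
Fixpoint path_event (s : seq 'I_4) : set T :=
  if s is l :: s' then
    path_event s' `&` X (size s) @^-1` [set endpoint e h s]
  else X 0 @^-1` [set e].

Let measurable_preX k B : measurable B -> measurable (X k @^-1` B).
Proof.
by move=> mB; rewrite -[_ @^-1` _]setTI; have [_ + _ _] := XM; apply.
Qed.

Lemma measurable_path_event s : measurable (path_event s).
Proof.
elim: s => [|l s IHs] /=; first by apply: measurable_preX; exact: measurable_point.
by apply: measurableI => //; by apply: measurable_preX; exact: measurable_point.
Qed.

Lemma path_eventE s : path_event s =
  [set w | forall k, (k <= size s)%N -> X k w = endpoint e h (drop (size s - k) s)].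
Proof.
elim: s => [|l s IHs].
  apply/seteqP; split => w /= => [+ k|/(_ 0%N (leqnn _))//].
  by rewrite leqn0 => + /eqP ->.
rewrite [path_event _]/= {}IHs; apply/seteqP; split => w /=.
  move=> [ws wl] k; rewrite leq_eqVlt ltnS => /predU1P[->|ks].
    by rewrite subnn.
  by rewrite subSn//= ws.
move=> ws; split; last by rewrite ws// subnn.
by move=> k ks; rewrite ws 1?leqW// subSn.
Qed.

Lemma path_event_endpoint s : path_event s `<=` X (size s) @^-1` [set endpoint e h s].
Proof. by case: s => [|l s] w //= []. Qed.

Lemma hop_inj : injective (@hop R h).
Proof.
move=> l l'; rewrite /hop /unit_step => -[/(mulfI h_neq0) + /(mulfI h_neq0)].
have n01 : (0 : R) <> 1 by apply/eqP; rewrite eq_sym oner_eq0.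
have n0N1 : (0 : R) <> - 1 by move/eqP; rewrite eq_sym oppr_eq0 oner_eq0.
have n1N1 : (1 : R) <> - 1.
  by move=> /eqP; rewrite -addr_eq0 -[1 + 1]/(2%:R) pnatr_eq0.
by case: l l' => -[|[|[|[|//]]]] i [[|[|[|[|//]]]] j] /= E1 E2;
  first [apply: val_inj; reflexivity|exfalso;
    first [exact: n01|exact: n0N1|exact: n1N1|by case: n01|by case: n0N1|by case: n1N1]].
Qed.

(** The four hops differ as soon as [h != 0], so distinct words trace distinct
    trajectories. *)
Lemma path_event_disjoint s s' : size s = size s' ->
  path_event s `&` path_event s' !=set0 -> s = s'.
Proof.
move=> ss' [w []]; elim: s s' ss' => [|l s IHs] [|l' s']//= [ss'] [ws wl] [ws' wl'].
have {IHs ws ws'} ? := IHs _ ss' ws ws'; subst s'.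
by move: wl'; rewrite wl => /addrI /hop_inj ->.
Qed.

Lemma probability_path_event s : P (path_event s) = (weight p s)%:E.
Proof.
have [_ _ P0 step] := XM.
elim: s => [|l s IHs]; first by rewrite /weight big_nil.
rewrite weight_cons EFinM -IHs [X in (_ = _ * P X)%E]path_eventE.
rewrite -(step (size s) (fun k => endpoint e h (drop (size s - k) s)) l).
rewrite [path_event _]/= path_eventE; congr (P _).
by apply/seteqP; split => w /=; rewrite subnn drop0 => -[].
Qed.

(** The trajectories that follow a word of [n] steps are disjoint and their
    probabilities, the weights, add up to 1: they exhaust the probability space
    up to a null set. *)
Lemma probability_split n A : measurable A ->
  P A = (\sum_(s <- words n) P (A `&` path_event s))%E.
Proof.
have cover B : measurable B -> P (B `&` \bigcup_(s in [set` words n]) path_event s) =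
    (\sum_(s <- words n) P (B `&` path_event s))%E.
  move=> mB; rewrite setI_bigcupr measure_fin_bigcup; [|exact: finite_seq| |].
  - by rewrite -fsbig_seq//; exact: words_uniq.
  - move=> s s' sn s'n [w [[_ ws] [_ ws']]].
    apply: path_event_disjoint; last by exists w.
    by rewrite (size_words sn) (size_words s'n).
  - by move=> s _; apply: measurableI => //; exact: measurable_path_event.
have total : P (\bigcup_(s in [set` words n]) path_event s) = 1%E.
  rewrite -[X in P X]setTI cover//.
  under eq_bigr do rewrite setTI probability_path_event.
  rewrite sumEFin; congr EFin; rewrite -[RHS](walk_mean_cst e h p_sum1 n 1).
  by apply: eq_bigr => s _; rewrite mulr1.
set U := \bigcup_(s in _) _ in cover total.
have mU : measurable U.
  by apply: fin_bigcup_measurable; [exact: finite_seq|move=> s _]; exact: measurable_path_event.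
move=> mA; rewrite -cover//.
rewrite -[in LHS](setIT A) -(setUv U) setIUr measureU//; last 3 first.
- exact: measurableI.
- by apply: measurableI => //; exact: measurableC.
- by rewrite setIACA setICr setI0.
rewrite [X in (_ + X)%E](_ : _ = 0%E) ?adde0//.
apply/eqP; rewrite eq_le measure_ge0 andbT.
apply: (@le_trans _ _ (P (~` U))).
  apply: le_measure; rewrite ?inE//.
    by apply: measurableI => //; exact: measurableC.
  exact: measurableC.
by rewrite probability_setC// total subee.
Qed.

Lemma markov_walk_law n B : measurable B ->
  P (X n @^-1` B) = (walk_mean p e h n \1_B)%:E.
Proof.
move=> mB; rewrite (probability_split n (measurable_preX n mB)).
rewrite -sumEFin; apply: eq_big_seq => s /size_words sn.
have Xs w : path_event s w -> X n w = endpoint e h s.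
  by rewrite -sn; exact: path_event_endpoint.
rewrite indicE; have [/set_mem Bs|/negP Bs] := boolP (_ \in _).
  rewrite mulr1 -probability_path_event; congr (P _).
  by apply/seteqP; split => [w []//|w ws]; split => //=; rewrite Xs.
rewrite mulr0 (_ : _ `&` _ = set0) ?measure0//.
by apply/seteqP; split => // w [/= + ws]; rewrite Xs// => /mem_set.
Qed.

End walk_law.

(** * Mean particle numbers *)

Section random_sum.
Context d (T : measurableType d) (R : realType) (P : probability T R).
Context (N : T -> nat) (b : nat -> T -> bool).
Hypotheses (mN : measurable_fun setT N) (mb : forall j, measurable [set w | b j w]).

Let term j := [set w | (j < N w)%N] `&` [set w | b j w].

Let measurable_term j : measurable (term j).
Proof.
apply: measurableI => //.
by rewrite -[X in measurable X]setTI; apply: (@mN _ [set k | (j < k)%N]).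
Qed.

Let random_sumE w :
  ((\sum_(j < N w) b j w)%N%:R : R)%:E = (\sum_(j <oo) (\1_(term j) w)%:E)%E.
Proof.
apply/esym/cvg_lim => //; apply: cvg_near_cst; near=> n.
have Nn : (N w <= n)%N by near: n; exact: nbhs_infty_ge.
rewrite /= sumEFin natr_sum -(big_mkord xpredT (fun j => (b j w)%:R)).
rewrite (big_nat_widen _ _ _ _ _ Nn) [in RHS]big_mkcond; congr (_%:E).
apply: eq_bigr => j _; rewrite indicE.
have -> : (w \in term j) = (j < N w)%N && b j w.
  by apply/idP/andP => [/set_mem//|jb]; exact/mem_set.
by case: (j < N w)%N.
Unshelve. all: by end_near. Qed.

Lemma measurable_random_sum :
  measurable_fun setT (fun w => ((\sum_(j < N w) b j w)%N%:R : R)%:E).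
Proof.
under eq_fun do rewrite random_sumE.
apply: ge0_emeasurable_sum => j *; first by rewrite lee_fin.
by apply/measurable_EFinP; exact: measurable_indic.
Qed.

(** A sum with a random number of terms is turned into a series of indicators,
    which commutes with the integral without any bound on the number of terms. *)
Lemma integral_random_sum :
  (\int[P]_w ((\sum_(j < N w) b j w)%N%:R : R)%:E =
   \sum_(j <oo) P ([set w | (j < N w)%N] `&` [set w | b j w]))%E.
Proof.
under eq_integral do rewrite random_sumE.
rewrite integral_nneseries//.
  by apply: eq_eseriesr => j _; rewrite integral_indic// setIT.
by move=> j; apply/measurable_EFinP; exact: measurable_indic.
Qed.

End random_sum.

Section expected_particles.
Context (R : realType) (p : 'I_4 -> R) (alpha : R) (e : R * R) (h : R).
Context (S : particle_system p alpha e h).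
Hypotheses (p_ge0 : forall l, 0 <= p l) (p_sum1 : \sum_l p l = 1).
Hypotheses (h_gt0 : 0 < h) (alpha_ge0 : 0 <= alpha).
Local Notation P := (ps_prob S).
Local Notation inj := (@injected _ _ _ _ _ S).
Local Notation wlk := (@walk _ _ _ _ _ S).

Lemma measurable_walk_at m j k x : measurable [set w | wlk m j k w == x].
Proof.
rewrite (_ : [set w | _] = wlk m j k @^-1` [set x]); last first.
  by apply/seteqP; split => w /= /eqP.
rewrite -[X in measurable X]setTI.
by have [_ + _ _] := walk_markov S m j; apply => //; exact: measurable_point.
Qed.

(** Wald's identity: the number of injected particles is independent of each of
    their walks, and these share the same law, so each term of the series factors
    and the mean number of injected particles comes out. *)
Lemma integral_injected_walk m k x :
  (\int[P]_w ((\sum_(j < inj m w) (wlk m j k w == x))%N%:R : R)%:E =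
   (alpha * h * walk_mean p e h k \1_[set x])%:E)%E.
Proof.
have mw j := measurable_walk_at m j k x.
have mN := @injected_measurable _ _ _ _ _ S m.
rewrite (integral_random_sum _ mN mw).
have mean : (alpha * h)%:E = (\sum_(j <oo) P [set w | (j < inj m w)%N])%E.
  rewrite -(injected_mean S m) unlock.
  have := integral_random_sum P mN (b := fun _ _ => true).
  under eq_eseriesr do rewrite set_true setIT.
  move=> <-; first by apply: eq_integral => w _; rewrite sum_nat_const card_ord muln1.
  by move=> j; rewrite set_true.
rewrite mulrC EFinM mean -nneseriesZl//.
apply: eq_eseriesr => j _.
have -> : (walk_mean p e h k \1_[set x])%:E = P (wlk m j k @^-1` [set x]).
  have wM := walk_markov S m j.
  by rewrite (markov_walk_law p_sum1 _ wM) ?gt_eqF//; exact: measurable_point.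
have ind := @ps_independent _ _ _ _ _ S [:: inl m; inr (m, j)] (fun i =>
  if i is inl _ then [set w | (j < inj m w)%N]
  else wlk m j k @^-1` [set x]).
move: ind; rewrite 2!big_cons big_nil mule1 [in X in _ -> X]muleC => <-//.
- congr (P _); apply/seteqP; split => w /=.
    by move=> [jN /eqP wx] i /=; rewrite !inE => /orP[] /eqP ->.
  move=> ind; split; first exact: (ind (inl m) (mem_head _ _)).
  by apply/eqP; apply: (ind (inr (m, j))); rewrite /= !inE eqxx orbT.
move=> i; rewrite !inE => /orP[] /eqP -> /=.
  by exists [set a | (j < a)%N].
by apply: sub_sigma_algebra; exists k, [set x]; split => //; exact: measurable_point.
Qed.

Lemma mean_atE n x : mean_at S n x =
  (\sum_(m < n.+1) alpha * h * walk_mean p e h m \1_[set x])%:E.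
Proof.
rewrite /mean_at unlock /particles_at.
pose f (m : 'I_n.+1) w : R :=
  (\sum_(j < inj m w) (wlk m j (n - m) w == x))%N%:R.
transitivity (\int[P]_w \sum_(m < n.+1) (f m w)%:E)%E.
  by apply: eq_integral => w _; rewrite sumEFin -natr_sum.
rewrite ge0_integral_sum//=; last by move=> m w _; rewrite lee_fin ler0n.
  rewrite -sumEFin [RHS](reindex_inj rev_ord_inj); apply: eq_bigr => m _.
  by rewrite integral_injected_walk /= subSS.
move=> m; apply: (@measurable_random_sum _ _ _ (inj m)
  (fun j w => wlk m j (n - m) w == x)) => [|j].
  exact: injected_measurable.
exact: measurable_walk_at.
Qed.

Lemma endpoint_lattice s : lattice h e -> lattice h (endpoint e h s).
Proof.
move=> he; elim: s => //= l s [a [b ->]].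
have [a' [b' ->]] : exists a' b' : int, hop h l = (h * a'%:~R, h * b'%:~R).
  rewrite /hop /unit_step; case: l => -[|[|[|[|//]]]] i /=;
  [exists 1, 0|exists 0, 1|exists (-1), 0|exists 0, (-1)];
  by rewrite ?mulrN1z ?mulr1z ?mulr0z.
by exists (a + a'), (b + b'); rewrite !intrD !mulrDr.
Qed.

Lemma round_down_lattice x : lattice h x -> round_down h x = x.
Proof.
move=> [a [b ->]]; rewrite /round_down /=.
by rewrite ![h * _ / h]mulrAC divff ?gt_eqF// !mul1r !intrKfloor.
Qed.

Lemma esum_indic1 (D : set (R * R)) (c : R) y : 0 <= c ->
  (\esum_(x in D) (c * \1_[set x] y)%:E = (c * \1_D y)%:E)%E.
Proof.
move=> c0; rewrite indicE; have [yD|yD] := boolP (y \in D).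
  rewrite (esumID [set y])//; last first.
    by move=> x _; rewrite lee_fin mulr_ge0.
  have -> : D `&` [set y] = [set y].
    by apply/setIidPr => _ ->; exact: set_mem.
  rewrite esum_set1 ?lee_fin ?mulr_ge0// indicE mem_set//.
  rewrite esum1 ?adde0// => x [_ /= xy].
  by rewrite indicE memNset ?mulr0// => yx; apply: xy.
rewrite mulr0 esum1// => x Dx; rewrite indicE memNset ?mulr0//= => yx.
by move/negP: yD; apply; rewrite yx; exact/mem_set.
Qed.

(** The walk never leaves the lattice, so that summing the masses of the lattice
    points of [A] recovers the full law of the walk on [A]. *)
Lemma path_measureE t A : lattice h e ->
  path_measure S t A =
  (\sum_(m < (Num.truncn (t / h)).+1) alpha * h * walk_mean p e h m \1_A)%:E.
Proof.
move=> he; rewrite /path_measure /scaled_mean; set n := Num.truncn _.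
transitivity (\esum_(x in A `&` lattice h) \sum_(m < n.+1)
    \sum_(s <- words m)
      (alpha * h * weight p s * \1_[set x] (endpoint e h s))%:E)%E.
  apply: eq_esum => x [_ /round_down_lattice ->].
  rewrite mean_atE -sumEFin; apply: eq_bigr => m _.
  by rewrite sumEFin mulr_sumr; congr (_%:E); apply: eq_bigr => s _; rewrite mulrA.
have c_ge0 s : 0 <= alpha * h * weight p s.
  by rewrite !mulr_ge0 ?(ltW h_gt0)// weight_ge0.
have t_ge0 s x : (0 <= (alpha * h * weight p s * \1_[set x] (endpoint e h s))%:E)%E.
  by rewrite lee_fin mulr_ge0.
rewrite esum_sum; last by move=> x m _ _; apply: sume_ge0.
rewrite -sumEFin; apply: eq_bigr => m _.
rewrite esum_sum// mulr_sumr -sumEFin; apply: eq_bigr => s _.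
rewrite esum_indic1// mulrA; congr (_ * _)%:E.
rewrite !indicE in_setI (mem_set (endpoint_lattice s he)) andbT//.
Qed.

End expected_particles.

(** * Integrals of bounded continuous functions *)

Section plane_integrals.
Context (R : realType).

(** Measurability in the plane refers to the product of the two Borel
    sigma-algebras; an open set belongs to it as a countable union of rectangles
    with rational corners. *)
Lemma open_measurable_plane (U : set (R * R)) : open U -> measurable U.
Proof.
move=> Uo.
pose rect (z : rat * rat * (rat * rat)) : set (R * R) :=
  `]ratr z.1.1, ratr z.1.2[%classic `*` `]ratr z.2.1, ratr z.2.2[%classic.
have -> : U = \bigcup_(z in [set z | rect z `<=` U]) rect z.
  apply/seteqP; split => [[x y] Uxy|x [z /= zU]]; last exact: zU.
  have [[A B] /= [/nbhs_ballP[a /= a0 aA] /nbhs_ballP[b /= b0 bB]] ABU] :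
    nbhs (x, y) U by exact: open_nbhs_nbhs.
  have near_rat (u r : R) : 0 < r -> exists l v : rat,
      [/\ ratr l < u, u < ratr v & forall s, ratr l < s < ratr v -> ball u r s].
    move=> r0.
    have /rat_in_itvoo[l] : u - r < u by lra.
    have /rat_in_itvoo[v] : u < u + r by lra.
    rewrite !in_itv/= => /andP[uv vr] /andP[rl lu].
    exists l, v; split => // s /andP[ls sv].
    by rewrite /ball/= ltr_norml; apply/andP; split; lra.
  have [l1 [v1 [lx xv bx]]] := near_rat x a a0.
  have [l2 [v2 [ly yv byy]]] := near_rat y b b0.
  exists ((l1, v1), (l2, v2)); last by split; rewrite /= in_itv/= ?lx ?ly.
  move=> [s t] [/= ]; rewrite !in_itv/= => sx ty.
  by apply: ABU; split => /=; [apply/aA/bx|apply/bB/byy].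
rewrite bigcup_mkcond; apply: countable_bigcupT_measurable => [|z].
  exact: countableP.
by case: ifP => _ //; apply: measurableX; exact: measurable_itv.
Qed.

Lemma continuous_measurable_plane (f : R * R -> R) :
  continuous f -> measurable_fun setT f.
Proof.
move=> /continuousP fc; apply: (measurability (@RGenOInfty.G R)).
  exact: RGenOInfty.measurableE.
move=> _ [_ [x ->] <-]; rewrite setTI; apply: open_measurable_plane.
by apply: fc; exact: interval_open.
Qed.

Lemma bounded_continuous_integrable (m : finmeas R) (f : R * R -> R) (K : R) :
  continuous f -> (forall x, `|f x| <= K) -> m.-integrable setT (EFin \o f).
Proof.
move=> fc fK; apply: measurable_bounded_integrable => //.
- by rewrite ltey_eq fin_num_measure.
- exact: continuous_measurable_plane.
- exists K; split; first exact: num_real.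
  by move=> M KM x _; apply: le_trans (fK x) (ltW KM).
Qed.

(** Transfer from nonnegative to bounded integrands: [f] is the difference of the
    nonnegative functions [f + K] and [K]. The functional [Lam] stands for an
    explicit formula, a finite sum or an integral along the ray. *)
Lemma Rintegral_shift (m : finmeas R) (Lam : (R * R -> R) -> R) (f : R * R -> R) (K : R) :
  (forall g : R * R -> R, continuous g -> (forall x, 0 <= g x) ->
     (\int[m]_x (g x)%:E = (Lam g)%:E)%E) ->
  Lam (fun x => f x + K) - Lam (cst K) = Lam f ->
  continuous f -> (forall x, `|f x| <= K) -> \int[m]_x f x = Lam f.
Proof.
move=> mLam <- fc fK.
have K0 : 0 <= K by apply: le_trans (fK 0).
have fKc : continuous (fun x => f x + K).
  by move=> x; apply: cvgD; [exact: fc|exact: cvg_cst].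
have fKb x : `|f x + K| <= K + K.
  by rewrite (le_trans (ler_normD _ _))// lerD// ger0_norm.
have Kc : continuous (cst K : R * R -> R) by exact: cst_continuous.
have Kb (x : R * R) : `|cst K x| <= K by rewrite ger0_norm.
rewrite [in LHS](_ : f = fun x => (f x + K) - cst K x); last first.
  by apply/funext => x /=; rewrite addrK.
rewrite RintegralB//; last 2 first.
- exact: bounded_continuous_integrable fKb.
- exact: bounded_continuous_integrable Kb.
rewrite /Rintegral !mLam//=.
by move=> x; have := fK x; rewrite ler_norml; lra.
Qed.

Section finite_support.
Context (I : Type) (c : I -> R) (y : I -> R * R).
Hypothesis c_ge0 : forall i, 0 <= c i.

(** Built one atom at a time, so that it inherits the measure structure of sums
    and multiples of measures. *)
Definition atoms (r : seq I) : {measure set (R * R) -> \bar R} :=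
  foldr (fun i m => [the measure _ _ of
    measure_add [the measure _ _ of mscale (NngNum (c_ge0 i)) (\d_(y i))] m])
  [the measure _ _ of mzero] r.

Lemma atomsE r A : atoms r A = (\sum_(i <- r) c i * \1_A (y i))%:E.
Proof.
elim: r => [|i r IHr]; first by rewrite big_nil.
by rewrite [LHS]measure_addE /mscale/= IHr big_cons EFinD EFinM.
Qed.

Lemma ge0_integral_atoms r (f : R * R -> R) :
  measurable_fun setT f -> (forall x, 0 <= f x) ->
  (\int[atoms r]_x (f x)%:E = (\sum_(i <- r) c i * f (y i))%:E)%E.
Proof.
move=> mf f0; have mEf : measurable_fun setT (EFin \o f) by exact/measurable_EFinP.
have Ef0 x : (0 <= (f x)%:E)%E by rewrite lee_fin.
elim: r => [|i r IHr]; first by rewrite integral_measure_zero big_nil.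
rewrite /= ge0_integral_measure_add// IHr ge0_integral_mscale//.
by rewrite integral_dirac// diracT mul1e big_cons EFinD EFinM.
Qed.

Lemma Rintegral_atoms (m : finmeas R) r (f : R * R -> R) (K : R) :
  (forall A, measurable A -> m A = (\sum_(i <- r) c i * \1_A (y i))%:E) ->
  continuous f -> (forall x, `|f x| <= K) ->
  \int[m]_x f x = \sum_(i <- r) c i * f (y i).
Proof.
move=> mE; apply: (@Rintegral_shift _ (fun f => \sum_(i <- r) c i * f (y i))).
  move=> g gc g0; rewrite -ge0_integral_atoms//; last exact: continuous_measurable_plane.
  by apply: eq_measure_integral => A mA _; rewrite atomsE; exact: mE.
by rewrite -sumrB; apply: eq_bigr => i _; rewrite -mulrBr addrK.
Qed.

End finite_support.

End plane_integrals.

(** An occupation measure, of the form [A |-> k * mu (D `&` phi @^-1` A)], is a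
    multiple of the image under [phi] of the restriction of [mu] to [D]; the
    limit [alpha * \int_0^t \d_(ray s) ds] is of this form. *)
Section occupation.
Local Open Scope ereal_scope.
Context d1 d2 (T1 : measurableType d1) (T2 : measurableType d2) (R : realType).
Context (mu : {measure set T1 -> \bar R}) (D : set T1) (mD : measurable D).

Lemma integral_mrestr (f : T1 -> \bar R) :
  measurable_fun setT f -> (forall x, 0 <= f x) ->
  \int[mrestr mu mD]_x f x = \int[mu]_(x in D) f x.
Proof.
move=> mf f0; rewrite -(setUv D) ge0_integral_setU//=; last 3 first.
- exact: measurableC.
- by rewrite setUv.
- exact/disj_setPCl.
rewrite (eq_measure_integral mu); last by move=> A _ AD; rewrite /= /mrestr (setIidl AD).
rewrite [X in _ + X](_ : _ = 0) ?adde0//.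
rewrite (eq_measure_integral mzero) ?integral_measure_zero// => A _ AD.
rewrite /= /mrestr (_ : A `&` D = set0) ?measure0//.
by apply/seteqP; split => // x [/AD].
Qed.

Lemma ge0_integral_occupation (phi : T1 -> T2) (k : {nonneg R})
    (m : {measure set T2 -> \bar R}) (f : T2 -> \bar R) :
  measurable_fun setT phi ->
  (forall A, measurable A -> m A = k%:num%:E * mu (phi @^-1` A `&` D)) ->
  measurable_fun setT f -> (forall x, 0 <= f x) ->
  \int[m]_x f x = k%:num%:E * \int[mu]_(s in D) f (phi s).
Proof.
move=> mphi mE mf f0.
pose rho : {measure set T1 -> \bar R} := mrestr mu mD.
(* the measurability of [phi] is a parameter of the measure structure of an
   image measure *)
pose nu := measure_function_pushforward__canonical__measure_function_Measure
  rho mphi.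
rewrite (eq_measure_integral (mscale k nu)); last by move=> A mA _; exact: mE.
rewrite ge0_integral_mscale//=; congr (_ * _).
have -> := ge0_integral_pushforward mphi rho measurableT mf (fun x _ => f0 x).
by rewrite preimage_setT integral_mrestr//; [exact: measurableT_comp mf mphi|move=> x; exact: f0].
Qed.

End occupation.

Section limit_integrals.
Context (R : realType) (alpha : {posnum R}) (e q : R * R).
Local Notation leb := (@lebesgue_measure R).

Lemma continuous_ray : continuous (ray e q).
Proof.
have lin (a b : R) : continuous (fun s : R => a + b * s).
  by move=> s; apply: cvgD; [exact: cvg_cst|apply: cvgM; [exact: cvg_cst|exact: cvg_id]].
by move=> s; exact: (cvg_pair (lin e.1 q.1 s) (lin e.2 q.2 s)).
Qed.

Lemma measurable_ray : measurable_fun setT (ray e q).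
Proof.
by apply: measurable_fun_pair; apply: measurable_funD => //; exact: measurable_funM.
Qed.

Lemma limit_measureE t A : measurable A -> limit_measure alpha e q t A =
  (alpha%:num%:E * leb (ray e q @^-1` A `&` `[0%R, t]))%E.
Proof.
move=> mA; congr (_ * _)%E.
rewrite -integral_indic//.
by rewrite -[X in measurable X]setTI; exact: measurable_ray.
Qed.

Lemma ge0_integral_limit_path t (g : R * R -> R) :
  continuous g -> (forall x, 0 <= g x) ->
  (\int[limit_path alpha e q t]_x (g x)%:E =
   alpha%:num%:E * \int[leb]_(s in `[0%R, t]) (g (ray e q s))%:E)%E.
Proof.
move=> gc g0.
have mI : measurable `[0%R, t]%classic by exact: measurable_itv.
apply: (@ge0_integral_occupation _ _ _ _ _ leb _ mI _ (NngNum (ltW (gt0 alpha))) _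
  (EFin \o g) measurable_ray) => [A mA| |x].
- exact: limit_measureE.
- by apply/measurable_EFinP; exact: continuous_measurable_plane.
- by rewrite lee_fin.
Qed.

Lemma continuous_integrable_itv (phi : R -> R) a b :
  continuous phi -> leb.-integrable `[a, b] (EFin \o phi).
Proof.
move=> phic; apply: continuous_compact_integrable; first exact: segment_compact.
exact: continuous_subspaceT.
Qed.

Lemma Rintegral_limit_path t (f : R * R -> R) (K : R) :
  continuous f -> (forall x, `|f x| <= K) ->
  \int[limit_path alpha e q t]_x f x =
  alpha%:num * \int[leb]_(s in `[0, t]) f (ray e q s).
Proof.
move=> fc fK.
have mI : measurable `[0%R, t]%classic by exact: measurable_itv.
have itg g : continuous g ->
    leb.-integrable `[0, t] (EFin \o (g \o ray e q)).
  move=> gc; apply: continuous_integrable_itv => s.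
  by apply: continuous_comp; [exact: continuous_ray|exact: gc].
apply: (@Rintegral_shift _ _ (fun g => alpha%:num * \int[leb]_(s in `[0, t]) g (ray e q s)) f K) => //.
  move=> g gc g0; rewrite ge0_integral_limit_path// EFinM fineK//.
  exact/integrable_fin_num/itg.
rewrite -mulrBr -RintegralB//.
- by congr (_ * _); apply: eq_Rintegral => s _; rewrite addrK.
- apply: (itg (fun x => f x + K)) => x.
  by apply: cvgD; [exact: fc|exact: cvg_cst].
- by apply: (itg (cst K)); exact: cst_continuous.
Qed.

End limit_integrals.

Section particle_integral.
Context (R : realType) (p : 'I_4 -> R) (alpha : R) (e : R * R) (h : R).
Context (S : particle_system p alpha e h).
Hypotheses (p_ge0 : forall l, 0 <= p l) (p_sum1 : \sum_l p l = 1).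
Hypotheses (he : admissible e h) (alpha_ge0 : 0 <= alpha).

Lemma Rintegral_measure_path t (f : R * R -> R) (K : R) :
  continuous f -> (forall x, `|f x| <= K) ->
  \int[measure_path S t]_x f x =
  \sum_(m < (Num.truncn (t / h)).+1) alpha * h * walk_mean p e h m f.
Proof.
move=> fc fK; have [h_gt0 e_lattice] := he; set n := Num.truncn _.
pose r := flatten [seq words m | m <- index_iota 0 n.+1].
pose c s := alpha * h * weight p s.
have sumE g : \sum_(m < n.+1) alpha * h * walk_mean p e h m g =
    \sum_(s <- r) c s * g (endpoint e h s).
  rewrite big_flatten big_map big_mkord; apply: eq_bigr => m _.
  by rewrite mulr_sumr; apply: eq_bigr => s _; rewrite mulrA.
rewrite sumE; apply: Rintegral_atoms fc fK => [s|A mA].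
  by rewrite !mulr_ge0 ?(ltW h_gt0)// weight_ge0.
by rewrite -sumE; exact: path_measureE.
Qed.

End particle_integral.

(** * Riemann sums *)

Section riemann_sums.
Context (R : realType) (phi : R -> R).
Hypothesis phi_cont : continuous phi.
Local Notation leb := (@lebesgue_measure R).
Local Notation F t := (\int[leb]_(s in `[0, t]) phi s).

(** With [c = phi s] this compares one cell of a Riemann sum with the integral;
    with [c = 0] it is the Lipschitz bound of the primitive. *)
Lemma Rintegral_increment (s t c eps : R) : 0 <= s -> s <= t ->
  (forall u, s <= u <= t -> `|phi u - c| <= eps) ->
  `|F t - F s - c * (t - s)| <= eps * (t - s).
Proof.
move=> s0 st phic.
rewrite Rintegral_itvB ?bnd_simp//; last exact: continuous_integrable_itv.
have mI : measurable `]s, t]%classic by exact: measurable_itv.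
have int g : continuous g -> leb.-integrable `]s, t] (EFin \o g).
  move=> gc; apply: integrableS (continuous_integrable_itv s t gc) => //.
  by apply: subset_itvr; rewrite bnd_simp.
have iphi := int _ phi_cont.
have icst a : leb.-integrable `]s, t] (EFin \o cst a).
  by apply: int => x; exact: cvg_cst.
have iphic : leb.-integrable `]s, t] (EFin \o (fun x => phi x - c)).
  by apply: int => x; apply: cvgB; [exact: phi_cont|exact: cvg_cst].
have cstE a : \int[leb]_(_ in `]s, t]) a = a * (t - s).
  rewrite Rintegral_cst//= lebesgue_measure_itv/= lte_fin.
  by move: st; rewrite le_eqVlt => /predU1P[->|->//]; rewrite ltxx subrr.
rewrite -(cstE c) -RintegralB//; last exact: icst.
apply: (le_trans (le_normr_Rintegral _ iphic)) => //.
rewrite -cstE; apply: le_Rintegral => //.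
- exact: (integrable_norm iphic).
- exact: icst.
- by move=> u /=; rewrite in_itv/= => /andP[su ut]; rewrite phic// (ltW su).
Qed.

(** The sum over [n.+1] cells covers [0, n.+1 * h], which overshoots [t] by at
    most one cell: hence the extra [K * h]. *)
Lemma riemann_sum_error (h K eps t : R) n : 0 < h ->
  n%:R * h <= t -> t <= n.+1%:R * h ->
  (forall (m : nat) (u : R), (m <= n)%N -> m%:R * h <= u <= m.+1%:R * h ->
     `|phi u - phi (m%:R * h)| <= eps) ->
  (forall u, `|phi u| <= K) ->
  `|\sum_(m < n.+1) h * phi (m%:R * h) - F t| <= eps * (n.+1%:R * h) + K * h.
Proof.
move=> h0 nt tn osc phiK.
have mh0 (m : nat) : 0 <= m%:R * h by rewrite mulr_ge0// ltW.
have stepE (m : nat) : m.+1%:R * h - m%:R * h = h.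
  by rewrite -mulrBl -natrB// subSnn mul1r.
have grid N : (N <= n.+1)%N ->
    `|\sum_(m < N) h * phi (m%:R * h) - F (N%:R * h)| <= eps * (N%:R * h).
  elim: N => [_|N IHN Nn].
    by rewrite big_ord0 mul0r mulr0 set_itv1 Rintegral_set1 subrr normr0.
  rewrite big_ord_recr/=.
  have mono : N%:R * h <= N.+1%:R * h by rewrite ler_pM2r// ler_nat.
  have := @Rintegral_increment _ _ (phi (N%:R * h)) eps (mh0 N) mono
    (fun u => osc N u Nn).
  rewrite stepE; move: (IHN (ltnW Nn)) => {IHN}.
  rewrite -[N.+1%:R]natr1 mulrDl mul1r mulrDr.
  rewrite [phi _ * h]mulrC.
  set a := \sum_(_ < _) _; set b := F _; set c := F _; set z := h * _.
  by rewrite !ler_norml => /andP[A1 A2] /andP[B1 B2]; apply/andP; split; lra.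
have t0 : 0 <= t by apply: le_trans nt.
have := @Rintegral_increment _ _ 0 K t0 tn (fun u _ => _).
rewrite mul0r subr0 => /(_ ltac:(by move=> u; rewrite subr0)).
have Kle : K * (n.+1%:R * h - t) <= K * h.
  rewrite ler_wpM2l//; first by apply: le_trans (phiK 0).
  by rewrite -[leRHS](stepE n) lerD2l lerN2.
have := grid _ (leqnn n.+1).
set a := \sum_(_ < _) _; set b := F _; set c := F _.
by rewrite !ler_norml => /andP[A1 A2] /andP[B1 B2]; apply/andP; split; lra.
Qed.

End riemann_sums.

(** * Convergence of test integrals, uniformly in time *)

Section uniform_estimate.
Context (R : realType) (e : R * R).

(** A continuous function need not be uniformly continuous on the plane, but it
    is uniformly so around the compact segment of the ray travelled up to time
    [T]; here [y] is an arbitrary point of the plane. *)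
Lemma ray_modulus (q : R * R) (f : R * R -> R) (T eps : R) : continuous f -> 0 < eps ->
  exists2 d : R, 0 < d & forall u : R, 0 <= u <= T -> forall y,
    sqdist y (ray e q u) < d -> `|f y - f (ray e q u)| <= eps.
Proof.
move=> fc eps0.
pose P d u := forall y, sqdist y (ray e q u) < d -> `|f y - f (ray e q u)| <= eps.
have /compact_near_coveringP/(_ _ (0 : R)^'+ P) := @segment_compact R 0 T.
have local u : `[0, T]%classic u -> \forall u' \near u & d \near 0^'+, P d u'.
  move=> _.
  have e20 : 0 < eps / 2 by rewrite divr_gt0.
  have /nbhs_ballP[r /= r0 fr] : nbhs (ray e q u) [set y | `|f (ray e q u) - f y| < eps / 2].
    exact: (cvgrPdist_lt _ _).1 (fc (ray e q u)) _ e20.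
  have r20 : 0 < r / 2 by rewrite divr_gt0.
  near=> u' d => y yd.
  have : ball (ray e q u) (r / 2) (ray e q u').
    by near: u'; exact: (continuous_ray (x := u)) (nbhsx_ballx _ _ r20).
  have dr : d < (r / 2) ^+ 2.
    by near: d; apply: nbhs_right_lt; rewrite exprn_gt0.
  rewrite /ball/= /prod_ball/= /ball/= => -[b1 b2].
  have {}yd := lt_trans yd dr.
  have sq_lt (z : R) : z ^+ 2 < (r / 2) ^+ 2 -> `|z| < r / 2.
    by rewrite -[z ^+ 2]real_normK ?num_real// ltr_pXn2r// nnegrE// ltW.
  have y1 : `|y.1 - (ray e q u').1| < r / 2.
    by apply/sq_lt/(le_lt_trans _ yd); rewrite lerDl sqr_ge0.
  have y2 : `|y.2 - (ray e q u').2| < r / 2.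
    by apply/sq_lt/(le_lt_trans _ yd); rewrite lerDr sqr_ge0.
  have /fr/= fy : ball (ray e q u) r y.
    split; rewrite /ball/=.
      by move: b1 y1; rewrite !ltr_norml/= => /andP[? ?] /andP[? ?]; apply/andP; split; lra.
    by move: b2 y2; rewrite !ltr_norml/= => /andP[? ?] /andP[? ?]; apply/andP; split; lra.
  have /fr/= fu' : ball (ray e q u) r (ray e q u').
    by split; rewrite /ball/=; apply: lt_trans (_ : r / 2 < r) => //; lra.
  move: fy fu'; rewrite !ltr_norml ler_norml => /andP[? ?] /andP[? ?].
  by apply/andP; split; lra.
move=> /(_ _ local) dP.
have [d [d0 Pd]] : exists d : R, 0 < d /\ `[0, T]%classic `<=` P d.
  near (0 : R)^'+ => d; exists d; split => //.
  by near: d.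
by exists d => // u uT; apply: Pd; rewrite /= in_itv.
Unshelve. all: by end_near. Qed.

Lemma sqdist_ray (q : R * R) u v :
  sqdist (ray e q u) (ray e q v) = (q.1 ^+ 2 + q.2 ^+ 2) * (u - v) ^+ 2.
Proof. by rewrite /sqdist /ray/=; ring. Qed.

Context (p : 'I_4 -> R) (alpha : {posnum R}).
Context (S : forall h : R, admissible e h -> particle_system p alpha%:num e h).
Hypotheses (p_ge0 : forall l, 0 <= p l) (p_sum1 : \sum_l p l = 1).

(** Both integrals are compared with a Riemann sum of [f] along the ray: the
    first by concentration of the walk after [m] steps around the point of the
    ray at time [m * h], the second by the oscillation of [f] over one cell. *)
Lemma uniform_test_convergence (f : R * R -> R) (K T eps : R) :
  continuous f -> (forall x, `|f x| <= K) -> 0 < eps ->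
  exists2 delta : R, 0 < delta & forall (h : R) (adm : admissible e h) (t : R),
    h < delta -> 0 <= t <= T ->
    `|\int[measure_path (S adm) t]_x f x -
      \int[limit_path alpha e (drift p) t]_x f x| <= eps.
Proof.
move=> fc fK eps0.
have [T0|T0] := ltP T 0.
  by exists 1 => // h adm t _ /andP[t0 /(le_trans t0)]; rewrite leNgt T0.
have : 0 < alpha%:num by [].
set q := drift p; set a := alpha%:num => a0.
have K0 : 0 <= K by apply: le_trans (fK 0).
have T1 : 0 < T + 1 by rewrite ltr_wpDl.
have eps1_gt0 : 0 < eps / (4 * a * (T + 1)).
  by rewrite divr_gt0// !mulr_gt0.
have [d d0 modulus] : exists2 d : R, 0 < d & forall u : R, 0 <= u <= T -> forall y,
    sqdist y (ray e q u) < d -> `|f y - f (ray e q u)| <= eps / (4 * a * (T + 1)).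
  by apply: ray_modulus => //; exact: eps1_gt0.
(* the error is [2 * a * (T + 1) * eps1], half of [eps] by this choice of
   [eps1], plus [a * h * C], which is small with [h] *)
set eps1 := eps / _ in eps1_gt0 modulus.
pose C := 2 * K / d * T * (T + 1) + K.
have C0 : 0 <= C by rewrite addr_ge0// !mulr_ge0 ?invr_ge0 ?addr_ge0// ltW.
have [delta delta0 Hdelta] : exists2 delta : R, 0 < delta & forall h : R,
    0 < h -> h < delta -> [/\ h < 1, a * h * C < eps / 2 &
    (q.1 ^+ 2 + q.2 ^+ 2) * h ^+ 2 < d].
  set Q := _ + _; have Q0 : 0 <= Q by rewrite addr_ge0 ?sqr_ge0.
  have C1 : 0 < 2 * a * (C + 1) by rewrite !mulr_gt0// ltr_wpDl.
  have Q1 : 0 < Q + 1 by rewrite ltr_wpDl.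
  exists (Num.min 1 (Num.min (eps / (2 * a * (C + 1))) (d / (Q + 1)))).
    by rewrite !lt_min ltr01 !divr_gt0.
  move=> h h0; rewrite !lt_min => /and3P[h1].
  rewrite !ltr_pdivlMr// => hC hQ; split => //.
    by have := mulr_gt0 a0 h0; lra.
  have : 0 <= Q * h * (1 - h) by rewrite !mulr_ge0 ?subr_ge0// ltW.
  by rewrite expr2; lra.
exists delta => // h adm t hdelta /andP[t0 tT].
have [h0 _] := adm.
have [h1 hC hq] := Hdelta h h0 hdelta.
rewrite (Rintegral_measure_path (S adm) p_ge0 p_sum1 adm (ltW a0) t fc fK).
rewrite (Rintegral_limit_path alpha e q t fc fK).
set n := Num.truncn (t / h).
have /andP[nt tn] : n%:R <= t / h < n.+1%:R.
  by apply: truncn_itv; rewrite divr_ge0// ltW.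
have {}nt : n%:R * h <= t by rewrite -ler_pdivlMr.
have {}tn : t <= n.+1%:R * h by rewrite -ler_pdivrMr// ltW.
have nh : n.+1%:R * h <= T + 1.
  by rewrite -natr1 mulrDl mul1r lerD// ?(le_trans nt)// ltW.
have mT m : (m <= n)%N -> 0 <= m%:R * h <= T.
  move=> mn; rewrite mulr_ge0 ?(ltW h0)//=.
  by apply: le_trans (le_trans nt tT); rewrite ler_pM2r// ler_nat.
have phic : continuous (f \o ray e q).
  by move=> s; apply: continuous_comp; [exact: continuous_ray|exact: fc].
have osc m (u : R) : (m <= n)%N -> m%:R * h <= u <= m.+1%:R * h ->
    `|f (ray e q u) - f (ray e q (m%:R * h))| <= eps1.
  move=> mn /andP[mu um]; apply: modulus; first exact: mT.
  apply: le_lt_trans hq.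
  rewrite sqdist_ray.
  rewrite ler_wpM2l ?addr_ge0 ?sqr_ge0// ler_pXn2r ?nnegrE ?(ltW h0)//; lra.
have := riemann_sum_error phic h0 nt tn osc (fun u => fK _).
set F := \int[_]_(s in _) _; set Sum := \sum_(m < n.+1) h * _ => riemann.
have walk : `|\sum_(m < n.+1) h * walk_mean p e h m f - Sum| <=
    n.+1%:R * h * (eps1 + 2 * K / d * (T * h)).
  rewrite -sumrB (le_trans (ler_norm_sum _ _ _))//.
  rewrite -mulrA mulr_natl -[X in _ *+ X]card_ord -sumr_const ler_sum// => m _.
  rewrite -mulrBr normrM gtr0_norm// ler_wpM2l ?(ltW h0)//.
  have mn : (m <= n)%N by rewrite -ltnS.
  apply: (le_trans (walk_mean_concentration p_ge0 p_sum1 d0 fK (modulus _ (mT m mn)))).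
  rewrite lerD2l ler_wpM2l//; first by rewrite divr_ge0 ?mulr_ge0// ltW.
  by rewrite expr2 mulrA ler_wpM2r ?(ltW h0)//; case/andP: (mT m mn).
have -> : \sum_(m < n.+1) a * h * walk_mean p e h m f =
    a * \sum_(m < n.+1) h * walk_mean p e h m f.
  by rewrite mulr_sumr; apply: eq_bigr => m _; rewrite mulrA.
rewrite -mulrBr normrM gtr0_norm//.
set W := \sum_(m < n.+1) _ in walk *.
have WF : `|W - F| <= (T + 1) * (eps1 + 2 * K / d * (T * h)) + (eps1 * (T + 1) + K * h).
  rewrite -(subrKA Sum) (le_trans (ler_normD _ _))// lerD//.
    rewrite (le_trans walk)// ler_wpM2r//.
    by rewrite addr_ge0 ?divr_ge0 ?mulr_ge0 ?addr_ge0// ?invr_ge0 ltW.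
  rewrite (le_trans riemann)// lerD2r ler_wpM2l//.
  by rewrite divr_ge0 ?mulr_ge0 ?addr_ge0// ltW.
apply: (le_trans (ler_wpM2l (ltW a0) WF)).
have -> : a * ((T + 1) * (eps1 + 2 * K / d * (T * h)) + (eps1 * (T + 1) + K * h)) =
    2 * (eps1 * (a * (T + 1))) + a * h * C by rewrite /C; ring.
have -> : eps1 * (a * (T + 1)) = eps / 4.
  rewrite /eps1; field; apply/andP; split; lra.
by lra.
Qed.

End uniform_estimate.

(** * Weak convergence and regularity of the paths *)

Section weak_convergence.
Context (R : realType).

(** Serves twice in [weak_cvg]: the weak topology is initial for the map into a
    product, whose topology is a supremum of initial ones. *)
Lemma cvg_initial (S : choiceType) (T : topologicalType) (g : S -> T)
    (F : set_system S) (s : S) :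
  Filter F -> g x @[x --> F] --> g s -> F --> (s : initial_topology g).
Proof.
move=> FF cvg_g U; rewrite nbhsE => -[B [[A oA <-] As] BU].
by apply: filterS BU _; apply: cvg_g; exact: open_nbhs_nbhs.
Qed.

Lemma weak_cvg (X : Type) (F : set_system X) (phi : X -> finmeas R) (m : finmeas R) :
  Filter F ->
  (forall f : bounded_continuous R,
     \int[phi x]_y (sval f y) @[x --> F] --> \int[m]_y (sval f y)) ->
  phi x @[x --> F] --> m.
Proof.
move=> FF cvg_test; apply: (@cvg_initial _ _ (@test_integrals R)).
by apply/cvg_sup => f; apply: cvg_initial; exact: cvg_test.
Qed.

(** By the triangle inequality an [r]-ball is open for [r], hence for the weak
    topology. *)
Lemma metrizes_weak_ball (r : finmeas R -> finmeas R -> R) m (eps : R) :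
  metrizes_weak r -> 0 < eps -> nbhs m [set m' | r m m' < eps].
Proof.
move=> [r_ge0 r_eq0 r_sym r_tri r_open] eps0.
apply: open_nbhs_nbhs; split; last first.
  by rewrite /= (_ : r m m = 0)//; exact/r_eq0.
apply/r_open => m' /= mm'; exists (eps - r m m'); first by rewrite subr_gt0.
by move=> m'' m'm''; apply: le_lt_trans (r_tri m m' m'') _; lra.
Qed.

Section limit_cadlag.
Context (alpha : {posnum R}) (e q : R * R).

Lemma limit_path_lipschitz (f : R * R -> R) (K s t : R) :
  continuous f -> (forall x, `|f x| <= K) -> 0 <= s -> s <= t ->
  `|\int[limit_path alpha e q t]_x f x - \int[limit_path alpha e q s]_x f x| <=
    alpha%:num * K * (t - s).
Proof.
move=> fc fK s0 st; rewrite !(Rintegral_limit_path alpha e q _ fc fK).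
rewrite -mulrBr normrM gtr0_norm// -mulrA ler_wpM2l//.
have phic : continuous (f \o ray e q).
  by move=> u; apply: continuous_comp; [exact: continuous_ray|exact: fc].
have := @Rintegral_increment _ _ phic s t 0 K s0 st.
by rewrite mul0r subr0; apply => u _; rewrite subr0; exact: fK.
Qed.

(** Freezing the path at its initial value on negative times makes it continuous
    on the whole line, so that neighbourhoods of time 0 need no special care. *)
Lemma limit_integral_continuous (f : R * R -> R) (K t : R) :
  continuous f -> (forall x, `|f x| <= K) -> 0 <= t ->
  \int[limit_path alpha e q (Num.max 0 s)]_x f x @[s --> t] -->
  \int[limit_path alpha e q t]_x f x.
Proof.
move=> fc fK t0.
have K0 : 0 <= K by apply: le_trans (fK 0).
apply/cvgrPdist_le => eps eps0; near=> s.
have lip : `|\int[limit_path alpha e q t]_x f x -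
    \int[limit_path alpha e q (Num.max 0 s)]_x f x| <=
    alpha%:num * K * `|t - Num.max 0 s|.
  have [st|st] := leP (Num.max 0 s) t.
    by rewrite [`|t - _|]ger0_norm ?subr_ge0// limit_path_lipschitz// le_max lexx.
  rewrite distrC [`|t - _|]ltr0_norm ?subr_lt0// opprB.
  by apply: limit_path_lipschitz => //; exact: ltW.
apply: (le_trans lip).
have close : `|t - s| < eps / (alpha%:num * K + 1).
  near: s; apply: (@nbhsx_ballx _ _ t).
  by rewrite divr_gt0// ltr_wpDl// mulr_ge0.
apply: (@le_trans _ _ (alpha%:num * K * `|t - s|)).
  rewrite ler_wpM2l ?mulr_ge0//.
  have [//|s0] := leP 0 s.
  by rewrite !ger0_norm; lra.
have P1 : 0 < alpha%:num * K + 1 by rewrite ltr_wpDl// mulr_ge0.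
move: close; rewrite ltr_pdivlMr// => /ltW; apply: le_trans.
by rewrite mulrC ler_wpM2l//; lra.
Unshelve. all: by end_near. Qed.

Lemma limit_path_continuous (t : R) : 0 <= t ->
  limit_path alpha e q (Num.max 0 s) @[s --> t] --> limit_path alpha e q t.
Proof.
move=> t0; apply: weak_cvg => -[f [fc [K fK]]] /=.
exact: limit_integral_continuous fc fK t0.
Qed.

Lemma limit_path_cadlag : cadlag (limit_path alpha e q).
Proof.
have freeze t (F : set_system R) : Filter F -> F `=>` nbhs t -> 0 <= t ->
    (\forall s \near F, 0 <= s) ->
    limit_path alpha e q s @[s --> F] --> limit_path alpha e q t.
  move=> FF Ft t0 F0; pose frozen s := limit_path alpha e q (Num.max 0 s).
  apply: (@cvg_trans _ (frozen @ F)).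
    by apply: near_eq_cvg; apply: filterS F0 => s s0; rewrite /frozen max_r.
  by apply: cvg_trans (limit_path_continuous t0); exact: cvg_app.
split=> t t0.
  apply: freeze => //; first exact: cvg_within.
  by near=> s; rewrite (le_trans t0)// ltW.
exists (limit_path alpha e q t); apply: freeze => //; first exact: cvg_within.
  exact: ltW.
by near=> s; near: s; apply: nbhs_left_ge.
Unshelve. all: by end_near. Qed.

End limit_cadlag.

Section path_cadlag.
Context (p : 'I_4 -> R) (alpha : R) (e : R * R) (h : R).
Context (S : particle_system p alpha e h).
Hypotheses (p_ge0 : forall l, 0 <= p l) (p_sum1 : \sum_l p l = 1).
Hypotheses (he : admissible e h) (alpha_ge0 : 0 <= alpha).

(** The path is constant on each [[n * h, (n + 1) * h[]; a filter concentrated on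
    one such interval gives both the right limit at a time of that interval and the
    left limit at its upper end. *)
Lemma measure_path_step (F : set_system R) (n : nat) (t : R) : Filter F ->
  (\forall s \near F, n%:R * h <= s < n.+1%:R * h) ->
  n%:R * h <= t < n.+1%:R * h ->
  measure_path S s @[s --> F] --> measure_path S t.
Proof.
move=> FF Fn nt; have [h0 _] := he.
have truncE s : n%:R * h <= s < n.+1%:R * h -> Num.truncn (s / h) = n.
  by move=> ns; apply: truncn_def; rewrite ler_pdivlMr// ltr_pdivrMr.
apply: weak_cvg => -[f [fc [K fK]]] /=.
apply: cvg_near_cst; apply: filterS Fn => s /truncE sE.
rewrite !(Rintegral_measure_path S p_ge0 p_sum1 he alpha_ge0 _ fc fK).
by rewrite sE truncE.
Qed.

Lemma measure_path_cadlag : cadlag (measure_path S).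
Proof.
have [h0 _] := he.
have itv t : 0 <= t -> (Num.truncn (t / h))%:R * h <= t < (Num.truncn (t / h)).+1%:R * h.
  move=> t0; have /truncn_itv : 0 <= t / h by rewrite divr_ge0// ltW.
  by rewrite ler_pdivlMr// ltr_pdivrMr.
split=> t t0.
  have /andP[nt tn] := itv t t0.
  apply: measure_path_step (itv t t0); near=> s; apply/andP; split.
    by apply: le_trans nt _; apply: ltW.
  by near: s; apply: nbhs_right_lt.
have [n nt tn] : exists2 n : nat, n%:R * h < t & t <= n.+1%:R * h.
  have /andP[] := itv t (ltW t0); set n := Num.truncn _.
  rewrite le_eqVlt => /predU1P[nt tn|nt tn]; last by exists n => //; exact: ltW.
  case: n nt tn => [|n] nt tn; first by move: t0; rewrite -nt mul0r ltxx.
  by exists n; rewrite -nt// ltr_pM2r// ltr_nat.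
exists (measure_path S (n%:R * h)).
apply: (@measure_path_step _ n); last by rewrite lexx ltr_pM2r// ltr_nat ltnS leqnn.
near=> s; apply/andP; split; last by apply: lt_le_trans tn.
by near: s; apply: nbhs_left_ge.
Unshelve. all: by end_near. Qed.

End path_cadlag.

End weak_convergence.

(** * The Skorohod distance *)

(** The integral of a nonnegative function is a supremum over the simple functions
    below it, and a larger function has more of them. This applies to the
    discounted distance of stopped paths, a supremum over uncountably many times. *)
Lemma le_integral_pointwise d (T : measurableType d) (R : realType)
    (m : {measure set T -> \bar R}) (D : set T) (f g : T -> \bar R) :
  (forall x, D x -> 0 <= f x)%E -> (forall x, D x -> f x <= g x)%E ->
  (\int[m]_(x in D) f x <= \int[m]_(x in D) g x)%E.
Proof.
move=> f0 fg; have g0 x : D x -> (0 <= g x)%E.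
  by move=> Dx; apply: le_trans (f0 x Dx) (fg x Dx).
rewrite !ge0_integralE//; apply: ereal_sup_le => _ [s /= sf <-].
by exists s => //= x; apply: le_trans (sf x) _; exact: lee_restrict.
Qed.

Lemma measurable_expRM (R : realType) (a : R) :
  measurable_fun setT (fun u : R => (expR (- a * u))%:E).
Proof.
by apply/measurable_EFinP; exact: measurableT_comp.
Qed.

Lemma integral_expR (R : realType) (a : R) : 0 < a ->
  (\int[lebesgue_measure]_(u in `[0%R, +oo[) (expR (- a * u))%:E = (a^-1)%:E)%E.
Proof.
move=> a0; have := integral_exponential_pdf a0.
have -> : (\int[lebesgue_measure]_x (exponential_pdf a x)%:E =
    \int[lebesgue_measure]_(u in `[0%R, +oo[) (a%:E * (expR (- a * u))%:E))%E.
  rewrite [RHS]integral_mkcond; apply: eq_integral => u _.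
  by rewrite /exponential_pdf !patchE; case: ifP.
rewrite ge0_integralZl ?lee_fin ?(ltW a0)//; last first.
  exact: measurable_funTS (measurable_expRM a).
set I := (\int[_]_(_ in _) _)%E.
case: I => [v| |]; last 2 first.
- by rewrite gt0_muley.
- by rewrite gt0_muleNy.
move=> [av]; congr (_%:E).
by apply: (mulfI (lt0r_neq0 a0)); rewrite av divff// gt_eqF.
Qed.

Section skorohod.
Context (R : realType) (r : finmeas R -> finmeas R -> R).
Hypothesis r_ge0 : forall m1 m2, 0 <= r m1 m2.
Local Notation leb := (@lebesgue_measure R).

Lemma time_change_id : time_change (@id R).
Proof. by split => //; rewrite image_id. Qed.

Lemma log_slope_id : (log_slope (@id R) <= 0)%E.
Proof.
apply: ge_ereal_sup => _ [[s t] /= /andP[t0 ts] <-].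
by rewrite divff ?ln1 ?normr0// subr_eq0 gt_eqF.
Qed.

(** The identity is the time change. Stopped before [T] the paths are [eta]-close;
    stopped at [u > T], their distance, truncated at 1, is at most
    [expR ((u - T) / 2)], a bound chosen so that, after discounting by
    [expR (- u)], the integrand is still an exponential. *)
Lemma skorohod_dist_uniform (x y : R -> finmeas R) (T eta : R) :
  (forall t : R, 0 <= t <= T -> r (x t) (y t) <= eta) -> 0 <= eta ->
  (skorohod_dist r x y <= (eta + 2 * expR (- (T / 2)))%:E)%E.
Proof.
move=> xy eta0; apply: ge_ereal_inf.
exists (maxe (log_slope (@id R)) (\int[lebesgue_measure]_(u in `[0%R, +oo[)
         ((expR (- u))%:E * stopped_dist r x y id u))%E).
  exists (@id R) => //; split; first exact: time_change_id.
  exact: le_lt_trans log_slope_id (ltry 0).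
rewrite ge_max; apply/andP; split.
  by apply: le_trans log_slope_id _; rewrite lee_fin addr_ge0 ?mulr_ge0 ?expR_ge0.
have D_ge0 u : (0 <= stopped_dist r x y id u)%E.
  apply: le_ereal_sup_tmp; exists (Num.min (r (x (Num.min 0 u)) (y (Num.min 0 u))) 1)%:E.
    by exists 0 => //=.
  by rewrite lee_fin le_min r_ge0 ler01.
have D_le (u : R) : 0 <= u -> (stopped_dist r x y id u <= (eta + expR ((u - T) / 2))%:E)%E.
  move=> u0; apply: ge_ereal_sup => _ [t /= t0 <-]; rewrite lee_fin.
  have tu0 : 0 <= Num.min t u by rewrite le_min t0.
  have [uT|Tu] := leP u T.
    rewrite ge_min; apply/orP; left.
    apply: le_trans (xy _ _) _; first by rewrite tu0 ge_min uT orbT.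
    by rewrite lerDl expR_ge0.
  rewrite ge_min; apply/orP; right.
  apply: (@le_trans _ _ (expR ((u - T) / 2))); last by rewrite lerDr.
  by rewrite -[X in X <= _]expR0 ler_expR; lra.
apply: (@le_trans _ _ (\int[leb]_(u in `[0%R, +oo[)
    (eta%:E * (expR (- 1 * u))%:E +
     (expR (- (T / 2)))%:E * (expR (- (2^-1) * u))%:E))%E).
  apply: le_integral_pointwise => u.
    by move=> _; rewrite mule_ge0 ?lee_fin ?expR_ge0.
  rewrite /= in_itv/= andbT => u0.
  apply: (le_trans (lee_wpmul2l _ (D_le u u0))).
    by rewrite lee_fin expR_ge0.
  rewrite -!EFinM -EFinD lee_fin mulrDr mulN1r [expR (- u) * eta]mulrC.
  rewrite -!expRD lerD2l ler_expR; lra.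
have mexp a := measurable_funTS (measurable_expRM a).
pose I : set R := `[0%R, +oo[%classic; rewrite -/I.
have mcexp (c a : R) : measurable_fun I (fun u : R => (c%:E * (expR (- a * u))%:E)%E).
  by apply: emeasurable_funM; [exact: measurable_cst|exact: mexp].
have cexp0 (c a : R) : 0 <= c -> forall u : R, I u ->
    (0 <= c%:E * (expR (- a * u))%:E)%E.
  by move=> c0 u _; rewrite -EFinM lee_fin mulr_ge0 ?expR_ge0.
have exp0 (a : R) : forall u : R, I u -> (0 <= (expR (- a * u))%:E)%E.
  by move=> u _; rewrite lee_fin expR_ge0.
have mI : measurable I by exact: measurable_itv.
rewrite ge0_integralD; [|exact: mI|exact: cexp0|exact: mcexp|
  by apply: cexp0; exact: expR_ge0|exact: mcexp].
rewrite ge0_integralZl; [|exact: mI|exact: mexp|exact: exp0|by rewrite lee_fin].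
rewrite ge0_integralZl; [|exact: mI|exact: mexp|exact: exp0|by rewrite lee_fin expR_ge0].
rewrite /I.
rewrite !integral_expR ?invr_gt0// invr1 invrK mule1 -EFinM -EFinD lee_fin.
by rewrite [2 * _]mulrC.
Qed.

End skorohod.

(** * Convergence of the paths *)

Section uniform_weak_convergence.
Context (R : realType) (p : 'I_4 -> R) (alpha : {posnum R}) (e : R * R).
Context (S : forall h : R, admissible e h -> particle_system p alpha%:num e h).
Hypotheses (p_ge0 : forall l, 0 <= p l) (p_sum1 : \sum_l p l = 1).
Local Notation mu := (limit_path alpha e (drift p)).

(** An [r]-ball contains a weak neighbourhood given by finitely many test
    functions, but these depend on its centre, so uniformity in time of each test
    integral is not enough. Instead the measures at times [s] close to [t] and mesh [h] close to 0
    converge weakly to the limit at [t], and compactness of [[0, T]] makes the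
    resulting [r]-bounds uniform. *)
Lemma uniform_weak_convergence (r : finmeas R -> finmeas R -> R) (T eta : R) :
  metrizes_weak r -> 0 < eta ->
  exists2 delta : R, 0 < delta & forall (h : R) (adm : admissible e h) (t : R),
    h < delta -> 0 <= t <= T -> r (measure_path (S adm) t) (mu t) < eta.
Proof.
move=> rW eta0; have [_ _ r_sym r_tri _] := rW.
pose P (h s : R) := 0 <= s -> forall adm : admissible e h,
  r (measure_path (S adm) s) (mu s) < eta.
(* [z] is a pair of a time and a mesh; negative times are read as 0, and at an
   inadmissible mesh [phi] follows the limit path, so that it converges along the
   full product filter *)
pose phi (z : R * R) : finmeas R := let s := Num.max 0 z.1 in
  if pselect (admissible e z.2) is left adm then measure_path (S adm) s else mu s.
have near_time (t : R) (Q : set R) : nbhs t Q ->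
    \forall z \near (nbhs t, (0 : R)^'+), Q z.1.
  by move=> tQ; exact: (cvg_fst tQ).
have phi_cvg (t : R) : 0 <= t ->
    phi z @[z --> (nbhs t, (0 : R)^'+)] --> mu t.
  move=> t0; apply: weak_cvg => -[f [fc [K fK]]] /=.
  apply/cvgrPdist_le => eps eps0.
  have eps20 : 0 < eps / 2 by rewrite divr_gt0.
  have [delta delta0 unif] :=
    uniform_test_convergence S p_ge0 p_sum1 (t + 1) fc fK eps20.
  have lim := limit_integral_continuous (alpha := alpha) (e := e) (q := drift p) fc fK t0.
  have near_lim : \forall s \near t,
      `|\int[mu t]_y f y - \int[mu (Num.max 0 s)]_y f y| <= eps / 2.
    by move/cvgrPdist_le : lim; exact.
  have near_t1 : \forall s \near t, s <= t + 1.
    apply: filterS (nbhsx_ballx t 1 ltr01) => s.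
    by rewrite /ball/= ltr_norml => /andP[? _]; lra.
  near=> z.
  have z1 : `|\int[mu t]_y f y - \int[mu (Num.max 0 z.1)]_y f y| <= eps / 2.
    by near: z; exact: (near_time t _ near_lim).
  have z2 : `|\int[phi z]_y f y - \int[mu (Num.max 0 z.1)]_y f y| <= eps / 2.
    rewrite /phi; case: pselect => [adm|_]; last by rewrite subrr normr0 ltW.
    apply: unif.
      by near: z; exact: (cvg_snd (nbhs_right_lt delta0)).
    rewrite le_max lexx/= ge_max addr_ge0//=.
    by near: z; exact: (near_time t _ near_t1).
  rewrite (splitr eps) (le_trans (ler_distD (\int[mu (Num.max 0 z.1)]_y f y) _ _))//.
  by rewrite lerD// distrC.
have /compact_near_coveringP/(_ _ (0 : R)^'+ P) := @segment_compact R 0 T.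
have local (t : R) : `[0, T]%classic t -> \forall s \near t & h \near 0^'+, P h s.
  rewrite /= in_itv/= => /andP[t0 _].
  have eta20 : 0 < eta / 2 by rewrite divr_gt0.
  have ballt := metrizes_weak_ball (mu t) rW eta20.
  have := phi_cvg t t0 _ ballt; rewrite nbhs_simpl/= => phit.
  have mut : \forall z \near (nbhs t, (0 : R)^'+), r (mu t) (mu (Num.max 0 z.1)) < eta / 2.
    exact: (near_time t _ (limit_path_continuous t0 ballt)).
  have FF : Filter (filter_prod (nbhs t) (0 : R)^'+) by exact: filter_prod_filter.
  apply: (filterS2 FF _ phit mut) => -[s h] /= phisht muts s0 adm.
  have phiE : phi (s, h) = measure_path (S adm) s.
    rewrite /phi /= max_r//; case: pselect => // adm'.
    by rewrite (Prop_irrelevance adm' adm).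
  rewrite max_r// in muts.
  rewrite -phiE; apply: le_lt_trans (r_tri _ (mu t) _) _.
  by rewrite r_sym (splitr eta) ltrD.
move=> /(_ _ local) hP.
have [delta delta0 deltaP] : exists2 delta : R, 0 < delta &
    forall h, 0 < h -> h < delta -> `[0, T]%classic `<=` P h.
  have /nbhs_ballP[delta /= delta0 deltaP] := hP.
  exists delta => // h h0 hd; apply: deltaP => //.
  by rewrite /ball/= sub0r normrN gtr0_norm.
exists delta => // h adm t hd tT; have [h0 _] := adm.
have /andP[t0 _] := tT.
by apply: (deltaP h h0 hd t).
Unshelve. all: by end_near. Qed.

End uniform_weak_convergence.

Theorem theorem3p2 (R : realType) (p : 'I_4 -> R) (alpha : {posnum R})
    (e : R * R)
    (S : forall h : R, admissible e h -> particle_system p alpha%:num e h)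
    (p_gt0 : forall l, 0 < p l)
    (p_sum1 : \sum_l p l = 1)
    (q_neq0 : `|p 0 - p 2| + `|p 1 - p 3| != 0)
    (e_site : exists h0 : R, 0 < h0 /\ lattice h0 e) :
  [/\ forall (h : R) (adm : admissible e h), cadlag (measure_path (S h adm)),
      cadlag (limit_path alpha e (drift p)) &
      forall r : finmeas R -> finmeas R -> R, metrizes_weak r ->
      forall eps : R, 0 < eps -> exists2 delta : R, 0 < delta &
      forall (h : R) (adm : admissible e h), h < delta ->
        (skorohod_dist r (measure_path (S h adm))
           (limit_path alpha e (drift p)) < eps%:E)%E].
Proof.
have p_ge0 l : 0 <= p l by exact: ltW.
split=> [h adm||r rW eps eps0].
- exact: measure_path_cadlag.
- exact: limit_path_cadlag.
(* chosen so that [2 * expR (- (T / 2)) = eps / 4] *)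
pose T := - (2 * ln (eps / 8)).
have eps40 : 0 < eps / 4 by rewrite divr_gt0.
have [delta delta0 unif] := uniform_weak_convergence S p_ge0 p_sum1 T rW eps40.
exists delta => // h adm hd; have [r_ge0 _ _ _ _] := rW.
apply: le_lt_trans (skorohod_dist_uniform r_ge0 (T := T) (eta := eps / 4) _ _) _.
- by move=> t tT; exact/ltW/unif.
- exact: ltW.
rewrite lte_fin /T.
have -> : - (- (2 * ln (eps / 8)) / 2) = ln (eps / 8) by lra.
by rewrite lnK ?posrE ?divr_gt0//; lra.
Qed.
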